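(* Let $n\geq 3$ and let $C_n$ be a spherical great polygon with $n$ sides, i.e. a circle in the plane partitioned into $n$ arc segments (sides) by $n$ distinct marked points on it. Let $d(C_n)$ be the number of disjoint pairs among the $n$ side disks of $C_n$ (that is, the number of unordered pairs of side disks of two different sides whose intersection is empty). Then $$\frac{(n-2)(n-3)}{2}\leq d(C_n)\leq \frac{n(n-3)}{2}.$$
   Context: A spherical great polygon $C_n$ is a circle in the Euclidean plane with $n$ distinct points (the vertices) marked on it; its sides are the $n$ arcs of the circle between two consecutive vertices which do not pass through any other vertex. For each side, its side disk is the unique (closed) disk whose center is the midpoint of that arc (the point of the arc bisecting it, lying on the circle) and whose boundary circle passes through the two end points of the arc. Two side disks intersect if they have at least one common point (boundaries included), and are disjoint otherwise; in particular the side disks of two adjacent sides always intersect, as they share a vertex. *)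

(* Defs.v *)
From mathcomp Require Import all_boot all_order all_algebra.
From mathcomp Require Import all_classical all_reals all_analysis.

Set Implicit Arguments.
Unset Strict Implicit.
Unset Printing Implicit Defensive.

Import Order.TTheory GRing.Theory Num.Theory.

Local Open Scope classical_set_scope.
Local Open Scope card_scope.
Local Open Scope ring_scope.

(* The library norm on R * R is the sup norm, hence an explicit Euclidean
   distance. *)
Definition edist (R : realType) (p q : R * R) : R :=
  Num.sqrt ((p.1 - q.1) ^+ 2 + (p.2 - q.2) ^+ 2).

Definition circle (R : realType) (c : R * R) (r : R) : set (R * R) :=
  [set p | edist p c = r].

Definition closed_disk (R : realType) (c : R * R) (r : R) : set (R * R) :=
  [set p | edist p c <= r].

Definition circle_pt (R : realType) (c : R * R) (r t : R) : R * R :=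
  (c.1 + r * cos t, c.2 + r * sin t).

Definition arc (R : realType) (c : R * R) (r a b : R) : set (R * R) :=
  [set circle_pt c r t | t in `[a, b]].

Definition great_polygon (R : realType) (n : nat) (c : R * R) (r : R)
    (V : set (R * R)) : Prop :=
  [/\ 0 < r, V `<=` circle c r & V #= `I_n].

(* The counterclockwise arc from angle a to angle b joins two consecutive
   vertices; a and b are determined by the arc up to a common multiple of
   2 * pi. *)
Definition consecutive (R : realType) (c : R * R) (r : R) (V : set (R * R))
    (a b : R) : Prop :=
  [/\ a < b < a + 2 * pi, V (circle_pt c r a), V (circle_pt c r b) &
      forall t, a < t < b -> ~ V (circle_pt c r t)].

(* S is a side of the polygon and D is its side disk. *)
Definition side_disk (R : realType) (c : R * R) (r : R) (V : set (R * R))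
    (S D : set (R * R)) : Prop :=
  exists a b rho : R,
    let m := circle_pt c r ((a + b) / 2) in
    [/\ consecutive c r V a b, S = arc c r a b,
        circle m rho (circle_pt c r a), circle m rho (circle_pt c r b) &
        D = closed_disk m rho].

(* Unordered pairs of sides, as two-element sets, whose side disks are
   disjoint. *)
Definition disjoint_pairs (R : realType) (c : R * R) (r : R)
    (V : set (R * R)) : set (set (set (R * R))) :=
  [set P | exists S1 S2 D1 D2 : set (R * R),
    [/\ side_disk c r V S1 D1, side_disk c r V S2 D2, S1 <> S2,
        D1 `&` D2 = set0 & P = [set S1; S2]]].

(* Main.v *)
Require Import Defs.
From mathcomp Require Import all_boot all_order all_algebra.
From mathcomp Require Import all_classical all_reals all_analysis.
From mathcomp Require Import ring lra zify.
Require Import Defs.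

Import Order.TTheory GRing.Theory Num.Theory.

Local Open Scope classical_set_scope.
Local Open Scope card_scope.
Local Open Scope ring_scope.

(** Cut the circle at a vertex and number the sides 0, ..., n - 1 by increasing
    angle.  Among the 'C(n, 2) pairs of sides, let m be the number of those
    whose disks meet, so that d = 'C(n, 2) - m; the two bounds on d amount to
    n <= m <= 2 n - 3.

    The lower bound on m holds because the n pairs of adjacent sides share a
    vertex (leq_card_meeting_pairs).  For the upper bound, draw a chord between
    the midpoints of two sides whenever their disks meet.  No two of these
    chords cross (no_crossing), so they form an outerplanar graph on n points
    of a circle, and such a graph has at most 2 n - 3 edges
    (noncrossing_card).

    Chords cannot cross for the following reason.  Let P1, P2, P3, P4 be the
    midpoints of four sides in cyclic order, suppose that the disks around P1
    and P3 meet, as well as those around P2 and P4, and let X be the common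
    point of the chords P1 P3 and P2 P4.  The radii around P1 and P3 add up to
    at least the length of P1 P3, so X lies in one of these two disks; likewise
    it lies in one of the disks around P2 and P4.  Hence X lies in the disks
    around two cyclically consecutive midpoints, say P1 and P2.  The law of
    sines in the triangle P1 P2 X excludes this (crossing_point_excluded).  The
    extreme case is that of two sides sharing a vertex: their circles meet
    again in the incenter of the triangle spanned by their ends, and X lies
    beyond that point. *)

(** * Sines of arcs and crossing chords *)

Lemma ler_sin_le_pi {R : realType} (x y : R) :
  0 <= x -> x <= y -> x + y <= pi -> sin x <= sin y.
Proof.
move=> x0 xy xypi.
pose u : R := (x + y) / 2; pose v : R := (y - x) / 2.
have -> : x = u - v by rewrite /u /v; field.
have -> : y = u + v by rewrite /u /v; field.
rewrite sinB sinD -subr_ge0.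
have cu : 0 <= cos u by apply: cos_ge0_pihalf; rewrite /u; lra.
have sv : 0 <= sin v by apply: sin_ge0_pi; rewrite /v; lra.
have := mulr_ge0 cu sv; lra.
Qed.

Lemma ltr_sin_lt_pi {R : realType} (x y : R) :
  0 <= x -> x < y -> x + y < pi -> sin x < sin y.
Proof.
move=> x0 xy xypi.
pose u : R := (x + y) / 2; pose v : R := (y - x) / 2.
have -> : x = u - v by rewrite /u /v; field.
have -> : y = u + v by rewrite /u /v; field.
rewrite sinB sinD -subr_gt0.
have cu : 0 < cos u by apply: cos_gt0_pihalf; rewrite /u; lra.
have sv : 0 < sin v by apply: sin_gt0_pi; rewrite /v; lra.
have := mulr_gt0 cu sv; lra.
Qed.

(** Ptolemy's theorem for four points on a circle of diameter 1, where the
    chord of an arc of angle 2 u has length sin u. *)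
Lemma sin_ptolemy {R : realType} (x y z : R) :
  sin x * sin (x + y + z) + sin y * sin z = sin (x + y) * sin (x + z).
Proof.
rewrite -[sin y * sin z]mul1r -(cos2Dsin2 x).
by rewrite -addrA !sinD cosD; ring.
Qed.

(** Consider a triangle P1 P2 X with angles y at P1 and z at P2 and with
    |P1 P2| = sin x.  By the law of sines the last two hypotheses say
    |P1 X| <= sin a and |P2 X| <= sin b.  Projecting X to P1 P2 gives
    sin x = |P1 X| cos y + |P2 X| cos z, which is then less than
    sin a cos b + sin b cos a = sin (a + b) <= sin x. *)
Lemma crossing_point_excluded {R : realType} (a b x y z : R) :
  0 < a -> 0 < b -> a + b <= x -> b < y -> a < z -> x + y + z < pi ->
  sin x * sin z <= sin a * sin (y + z) ->
  sin x * sin y <= sin b * sin (y + z) -> False.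
Proof.
move=> a0 b0 abx bby az xyz ha hb.
have sx : 0 < sin x by apply: sin_gt0_pi; lra.
have sy : 0 < sin y by apply: sin_gt0_pi; lra.
have sz : 0 < sin z by apply: sin_gt0_pi; lra.
have sa : 0 < sin a by apply: sin_gt0_pi; lra.
have sb : 0 < sin b by apply: sin_gt0_pi; lra.
have syz : 0 < sin (y + z) by apply: sin_gt0_pi; lra.
(* An obtuse angle at P1 makes P2 X the longest side, yet it is at most
   sin b < sin x; the case of an obtuse angle at P2 is symmetric. *)
have [cy|cy] := ltP (cos y) 0.
  have lt1 : sin b < sin x by apply: ltr_sin_lt_pi; lra.
  have le2 : sin (y + z) <= sin y.
    rewrite sinD; have h1 := cos_le1 z.
    have := nmulr_rle0 (sin z) cy; rewrite (ltW sz) => h2.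
    have := ler_wpM2l (ltW sy) h1; lra.
  have := ler_wpM2l (ltW sb) le2.
  have := lt1; rewrite -(ltr_pM2r sy); lra.
have [cz|cz] := ltP (cos z) 0.
  have lt1 : sin a < sin x by apply: ltr_sin_lt_pi; lra.
  have le2 : sin (y + z) <= sin z.
    rewrite sinD; have h1 := cos_le1 y.
    have := nmulr_rle0 (sin y) cz; rewrite (ltW sy) => h2.
    have := ler_wpM2l (ltW sz) h1; lra.
  have := ler_wpM2l (ltW sa) le2.
  have := lt1; rewrite -(ltr_pM2r sz); lra.
have hx : sin x <= sin a * cos y + sin b * cos z.
  rewrite -(ler_pM2r syz).
  have h1 := ler_wpM2l cy ha; have h2 := ler_wpM2l cz hb.
  have e : sin x * sin (y + z) =
      cos y * (sin x * sin z) + cos z * (sin x * sin y) by rewrite sinD; ring.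
  rewrite e; lra.
have cyb : cos y < cos b by rewrite ltr_cos // in_itv /=; lra.
have cza : cos z < cos a by rewrite ltr_cos // in_itv /=; lra.
have hab : sin (a + b) <= sin x by apply: ler_sin_le_pi; lra.
rewrite sinD [cos a * _]mulrC in hab.
have h1 : sin a * cos y < sin a * cos b by rewrite ltr_pM2l.
have h2 : sin b * cos z < sin b * cos a by rewrite ltr_pM2l.
by have := le_lt_trans hx (ltrD h1 h2); rewrite ltNge hab.
Qed.

(** Four points P1, P2, P3, P4 on a circle of diameter 1 bound arcs of angles
    2 x, 2 y, 2 z, 2 t, and they are the centers of disks of radii sin a, sin b,
    sin c, sin d.  The last two hypotheses bound the diagonals P1 P3 and P2 P4
    by sums of radii.  The diagonals cross in X at an angle of sine
    sin (x + z), and |P1 X| = sin x sin t / sin (x + z), similarly for the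
    other points; so X is in a disk around an end of each diagonal. *)
Lemma crossing_sin {R : realType} (a b c d x y z t : R) :
  0 < a -> 0 < b -> 0 < c -> 0 < d ->
  a + b <= x -> b + c <= y -> c + d <= z -> d + a <= t -> x + y + z + t = pi ->
  sin (x + y) <= sin a + sin c -> sin (y + z) <= sin b + sin d -> False.
Proof.
move=> a0 b0 c0 d0 abx bcy cdz dat tot hac hbd.
have et : sin t = sin (x + y + z).
  have -> : t = - (x + y + z) + pi by lra.
  by rewrite sinDpi sinN opprK.
have eyt : sin (y + t) = sin (x + z).
  have -> : y + t = - (x + z) + pi by lra.
  by rewrite sinDpi sinN opprK.
have s0 : 0 < sin (x + z) by apply: sin_gt0_pi; lra.
(* p1 and p2 express that X splits each diagonal into two segments. *)
have p1 := sin_ptolemy x y z.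
have p2 : sin x * sin y + sin z * sin (x + y + z) = sin (x + z) * sin (y + z).
  have -> : x + y + z = z + x + y by lra.
  by rewrite addrC sin_ptolemy (addrC z) (addrC z).
have h1 := hac; rewrite -(ler_pM2r s0) -p1 -et mulrDl in h1.
have h2 := hbd; rewrite -(ler_pM2l s0) -p2 -et mulrDr in h2.
have [ha|ha] := leP (sin x * sin t) (sin a * sin (x + z));
have [hb|hb] := leP (sin x * sin y) (sin b * sin (x + z)).
- by apply: (@crossing_point_excluded _ a b x y t); rewrite ?eyt //; lra.
- by apply: (@crossing_point_excluded _ d a t x z) => //; lra.
- by apply: (@crossing_point_excluded _ b c y z x); rewrite // ?(addrC z x); lra.
- by apply: (@crossing_point_excluded _ c d z t y); rewrite // ?(addrC t y) ?eyt; lra.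
Qed.

(** * Points on a circle in the Euclidean plane *)

(** The triangle inequality of the plane; it reduces to the Cauchy-Schwarz
    inequality, itself a consequence of Lagrange's identity. *)
Lemma minkowski2 {R : realType} (a b e f : R) :
  Num.sqrt ((a + e) ^+ 2 + (b + f) ^+ 2) <=
  Num.sqrt (a ^+ 2 + b ^+ 2) + Num.sqrt (e ^+ 2 + f ^+ 2).
Proof.
have PE : Num.sqrt (a ^+ 2 + b ^+ 2) ^+ 2 = a ^+ 2 + b ^+ 2.
  by rewrite sqr_sqrtr ?addr_ge0 ?sqr_ge0.
have QE : Num.sqrt (e ^+ 2 + f ^+ 2) ^+ 2 = e ^+ 2 + f ^+ 2.
  by rewrite sqr_sqrtr ?addr_ge0 ?sqr_ge0.
move: (sqrtr_ge0 (a ^+ 2 + b ^+ 2)) (sqrtr_ge0 (e ^+ 2 + f ^+ 2)) PE QE.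
move: (Num.sqrt (a ^+ 2 + b ^+ 2)) (Num.sqrt (e ^+ 2 + f ^+ 2)) => P Q.
move=> P0 Q0 PE QE.
have cs : a * e + b * f <= P * Q.
  rewrite (le_trans (ler_norm _)) // -ler_sqr ?nnegrE ?mulr_ge0 //.
  rewrite real_normK ?num_real // exprMn PE QE -subr_ge0.
  have -> : (a ^+ 2 + b ^+ 2) * (e ^+ 2 + f ^+ 2) - (a * e + b * f) ^+ 2 =
    (a * f - b * e) ^+ 2 by ring.
  exact: sqr_ge0.
rewrite -ler_sqr ?nnegrE ?sqrtr_ge0 ?addr_ge0 //.
rewrite sqr_sqrtr ?addr_ge0 ?sqr_ge0 //.
have -> : (P + Q) ^+ 2 = P ^+ 2 + Q ^+ 2 + 2 * (P * Q) by ring.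
rewrite PE QE; lra.
Qed.

Lemma edist_triangle {R : realType} (p q m : R * R) :
  edist p q <= edist p m + edist m q.
Proof.
rewrite /edist; apply: le_trans (minkowski2 _ _ _ _).
by rewrite !addrA !subrK.
Qed.

Lemma edistC {R : realType} (p q : R * R) : edist p q = edist q p.
Proof. by rewrite /edist -(opprB q.1) -(opprB q.2) !sqrrN. Qed.

Lemma edist_circle_pt {R : realType} (c : R * R) (r s u : R) : 0 <= r ->
  edist (circle_pt c r s) (circle_pt c r u) = 2 * r * `|sin ((s - u) / 2)|.
Proof.
move=> r0; rewrite /edist /circle_pt /=.
pose x : R := (s + u) / 2; pose y : R := (s - u) / 2.
have -> : s = x + y by rewrite /x /y; field.
have -> : u = x - y by rewrite /x /y; field.
have -> : (x + y - (x - y)) / 2 = y by field.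
rewrite !cosD !sinD cosN sinN.
have -> : 2 * r * `|sin y| = `|2 * r * sin y|.
  by rewrite normrM (ger0_norm (mulr_ge0 _ r0)).
rewrite -sqrtr_sqr; congr Num.sqrt.
have -> : (2 * r * sin y) ^+ 2 =
   (2 * r * sin y) ^+ 2 * (cos x ^+ 2 + sin x ^+ 2) by rewrite cos2Dsin2 mulr1.
ring.
Qed.

Lemma circle_pt_period {R : realType} (c : R * R) (r s : R) (k : int) :
  circle_pt c r (s + k%:~R * (2 * pi)) = circle_pt c r s.
Proof.
have nat_period n u : circle_pt c r (u + n%:R * (2 * pi)) = circle_pt c r u.
  have -> : n%:R * (2 * pi) = (pi *+ 2) *+ n :> R.
    by rewrite -[RHS]mulr_natl -[pi *+ 2]mulr_natl.
  by rewrite /circle_pt (periodicn (@cosD2pi R)) (periodicn (@sinD2pi R)).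
case: k => n; first exact: nat_period.
rewrite NegzE mulrNz mulNr.
by rewrite -[in RHS](subrK (n.+1%:R * (2 * pi)) s) nat_period.
Qed.

Lemma circle_pt_turn {R : realType} (c : R * R) (r s : R) :
  circle_pt c r (s + 2 * pi) = circle_pt c r s.
Proof. by rewrite -[RHS](circle_pt_period _ _ _ 1) mulr1z mul1r. Qed.

(** After reducing the difference of the angles to v in [0, 2 pi), the distance
    of the two points is 2 r sin (v / 2), which vanishes for v = 0 only. *)
Lemma circle_pt_inj_mod {R : realType} (c : R * R) (r s u : R) : 0 < r ->
  circle_pt c r s = circle_pt c r u -> exists k : int, s = u + k%:~R * (2 * pi).
Proof.
move=> r0 e.
have pi0 : 0 < pi :> R := pi_gt0 R.
pose k := Num.floor ((s - u) / (2 * pi)).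
exists k; pose v := s - u - k%:~R * (2 * pi).
have v0 : 0 <= v < 2 * pi.
  have tp : 0 < 2 * pi :> R by lra.
  have := floor_itv ((s - u) / (2 * pi)); rewrite -/k.
  by rewrite ler_pdivlMr // ltr_pdivrMr // intrD mulrDl /v => /andP[]; lra.
have : edist (circle_pt c r (u + v)) (circle_pt c r u) = 0.
  have -> : u + v = s + (- k)%:~R * (2 * pi) by rewrite /v mulrNz; ring.
  by rewrite circle_pt_period e /edist !subrr expr0n addr0 sqrtr0.
rewrite edist_circle_pt ?ltW // addrC addKr.
have [v_eq0|vN0] := eqVneq v 0; first by move=> _; rewrite /v in v_eq0; lra.
have {vN0} vgt0 : 0 < v by rewrite lt_def vN0; lra.
have : 0 < sin (v / 2) by apply: sin_gt0_pi; lra.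
by move=> sv /eqP; rewrite !mulf_eq0 normr_eq0 !gt_eqF.
Qed.

Lemma circle_pt_inj_turn {R : realType} (c : R * R) (r x s u : R) :
  0 < r -> x <= s < x + 2 * pi -> x <= u < x + 2 * pi ->
  circle_pt c r s = circle_pt c r u -> s = u.
Proof.
move=> r0 xs xu /(circle_pt_inj_mod _ _ _ _ r0)[k e].
have pi0 : 0 < 2 * pi :> R by rewrite mulr_gt0 ?pi_gt0.
have k_lt1 : k < 1.
  rewrite -(ltr_int R) -(ltr_pM2r pi0); lra.
have k_gtN1 : -1 < k.
  rewrite -(ltr_int R) -(ltr_pM2r pi0); lra.
have k0 : k = 0 by lia.
by rewrite e k0 mul0r addr0.
Qed.

Lemma circle_angle {R : realType} (c p : R * R) (r : R) : 0 < r ->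
  circle c r p -> exists2 s, 0 <= s < 2 * pi & p = circle_pt c r s.
Proof.
move=> r0 cp.
pose x := (p.1 - c.1) / r; pose y := (p.2 - c.2) / r.
have xy1 : x ^+ 2 + y ^+ 2 = 1.
  have : (p.1 - c.1) ^+ 2 + (p.2 - c.2) ^+ 2 = r ^+ 2.
    by rewrite -cp /edist sqr_sqrtr // addr_ge0 ?sqr_ge0.
  rewrite /x /y !expr_div_n -mulrDl => ->.
  by rewrite mulfV // expf_neq0 ?gt_eqF.
have px : p.1 = c.1 + r * x by rewrite /x mulrC divfK ?gt_eqF // addrC subrK.
have py : p.2 = c.2 + r * y by rewrite /y mulrC divfK ?gt_eqF // addrC subrK.
have x1 : -1 <= x <= 1.
  have : x ^+ 2 <= 1 by have := sqr_ge0 y; lra.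
  by rewrite -ler_norml -(@expr_le1 _ 2 `|x|) // real_normK ?num_real.
have cx : cos (acos x) = x by rewrite acosK // in_itv.
have sx : sin (acos x) = `|y|.
  by rewrite sin_acos // -sqrtr_sqr; congr Num.sqrt; lra.
have a0 := acos_ge0 x1; have api := acos_lepi x1; have pi0 := pi_gt0 R.
(* acos covers the upper half circle only; on the lower one use
   2 pi - acos x, which is less than 2 pi since x < 1 there. *)
have [y0|y0] := leP 0 y.
  exists (acos x); first lra.
  by rewrite /circle_pt cx sx ger0_norm // -px -py; case: (p).
have x_lt1 : x < 1.
  rewrite lt_neqAle; case/andP: x1 => _ ->; rewrite andbT.
  apply/eqP => xe; have : 0 < y ^+ 2 by rewrite exprn_even_gt0 //= lt_eqF.
  by rewrite xe expr1n in xy1; lra.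
have agt0 : 0 < acos x by apply: acos_gt0; case/andP: x1 => ->.
exists (- acos x + 2 * pi); first lra.
rewrite circle_pt_turn /circle_pt cosN sinN cx sx ltr0_norm // opprK -px -py.
by case: (p).
Qed.

(** * Noncrossing sets of pairs *)

(** The pairs are edges, oriented from the smaller to the larger end, between
    points 0, ..., n - 1 placed on a circle. *)
Definition noncrossing {n : nat} (E : {set 'I_n * 'I_n}) : Prop :=
  (forall e, e \in E -> e.1 < e.2)%N /\
  forall i j k l : 'I_n, (i < j < k)%N -> (k < l)%N ->
    (i, k) \in E -> (j, l) \in E -> False.

(** Induction on q - p.  Let k < q be the largest neighbour of p above p, or
    p + 1 if there is none.  Every edge other than (p, q) then stays on one
    side of k: an edge that jumps over k and starts after p crosses (p, k), and
    one that starts at p contradicts the choice of k.  With the bounds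
    2 (k - p) - 1 and 2 (q - k) - 1 for the two sides, the total is at most
    2 (q - p) - 1. *)
Lemma noncrossing_card_between {n : nat} (E : {set 'I_n * 'I_n}) :
  noncrossing E -> forall p q : 'I_n, (p < q)%N ->
  (#|[set e in E | (p <= e.1)%N && (e.2 <= q)%N]|.+1 <= (q - p).*2)%N.
Proof.
move=> [Elt Ecross] p q.
have [m] := ubnP (q - p); elim: m p q => // m IH p q; rewrite ltnS => qpm pq.
have [qp1|qp1] := eqVneq (q : nat) p.+1.
  have sub : [set e in E | (p <= e.1)%N && (e.2 <= q)%N] \subset [set (p, q)]%SET.
    apply/fintype.subsetP => -[i j]; rewrite !inE /= => /andP[/Elt /= ij /andP[pi jq]].
    by rewrite xpair_eqE -!val_eqE /=; lia.
  by have := subset_leq_card sub; rewrite cards1; lia.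
have p1n : (p.+1 < n)%N by have := ltn_ord q; lia.
pose S (k : 'I_n) := (p < k < q)%N && ((k == Ordinal p1n) || ((p, k) \in E)).
have S0 : S (Ordinal p1n) by rewrite /S eqxx /=; lia.
case: (arg_maxnP (fun k : 'I_n => k : nat) S0) => k /andP[/andP[pk kq] Sk] kmax.
have sub : [set e in E | (p <= e.1)%N && (e.2 <= q)%N] \subset
    (p, q) |: ([set e in E | (p <= e.1)%N && (e.2 <= k)%N] :|:
               [set e in E | (k <= e.1)%N && (e.2 <= q)%N]).
  apply/fintype.subsetP => -[i j]; rewrite !inE /= => /andP[Eij /andP[pi jq]].
  rewrite Eij pi jq /= andbT; have /= ij := Elt _ Eij.
  have [kj|kj] := leqP j k; first by rewrite /= orbT.
  have [ik|ik] := leqP k i; first by rewrite /= orbT.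
  rewrite !orbF; have [pei|pni] := eqVneq (p : nat) i.
    have {}pei : p = i by exact: val_inj.
    rewrite -pei in Eij *; rewrite xpair_eqE eqxx; apply/negP => /negP jNq.
    have : S j.
      by rewrite /S Eij orbT andbT; move: jNq; rewrite -val_eqE /=; lia.
    by move/kmax; lia.
  case/orP: Sk => [/eqP kp|Epk]; first by move: ik; rewrite kp /=; lia.
  exfalso; apply: (Ecross p i k j) => //; lia.
have := subset_leq_card sub; rewrite cardsU1.
have [+ _] := leq_card_setU [set e in E | (p <= e.1)%N && (e.2 <= k)%N]
               [set e in E | (k <= e.1)%N && (e.2 <= q)%N].
have := IH p k ltac:(lia) pk; have := IH k q ltac:(lia) kq.
case: (_ \notin _); lia.
Qed.

Lemma noncrossing_card {n : nat} (E : {set 'I_n.+2 * 'I_n.+2}) :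
  noncrossing E -> (#|E|.+1 <= n.+1.*2)%N.
Proof.
move=> ncE; have := noncrossing_card_between _ ncE ord0 ord_max.
rewrite /= subn0 => /(_ isT); congr (_ < _)%N; congr #|pred_of_set _|.
by apply/setP => e; rewrite !inE leq_ord andbT.
Qed.

Lemma card_increasing_pairs n :
  #|[set e : 'I_n * 'I_n | (e.1 < e.2)%N]%SET| = 'C(n, 2).
Proof.
rewrite -bin2_sum big_mkord -sum1dep_card.
rewrite -(pair_big_dep xpredT (fun i j : 'I_n => i < j)%N (fun _ _ => 1%N)) /=.
rewrite (exchange_big_dep xpredT) //=; apply: eq_bigr => j _.
rewrite -(big_ord_widen n (fun _ => 1%N)) ?sum1_card ?card_ord //.
exact: ltnW.
Qed.

(** * The angles of the vertices *)

Lemma exists_enumeration {T : Type} (t0 : T) (V : set T) (n : nat) :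
  V #= `I_n -> exists f : nat -> T, set_bij `I_n V f.
Proof.
move=> /card_esym; elim/Ppointed: T => T in t0 V *.
  by have := no t0.
by move=> ?; apply/bijPex/pcard_eqP.
Qed.

(** The vertices have the angles t 0 < ... < t (n - 1), and t n is the angle
    t 0 after a full turn, so that the sides are the arcs from t i to t (i + 1)
    for all i < n, the one through the cut included. *)
Definition vertex_angles {R : realType} (c : R * R) (r : R) (V : set (R * R))
    (n : nat) (t : nat -> R) : Prop :=
  [/\ forall i, (i < n)%N -> t i < t i.+1, t n = t 0%N + 2 * pi &
      forall p, V p <-> exists2 i, (i < n)%N & p = circle_pt c r (t i)].

(** The angles in [0, 2 pi) of the vertices, sorted. *)
Lemma exists_vertex_angles {R : realType} (n : nat) (c : R * R) (r : R)
    (V : set (R * R)) : (0 < n)%N -> great_polygon n c r V ->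
  exists t, vertex_angles c r V n t.
Proof.
move=> n0 [r0 Vcirc Vn].
have [f [Vf Vinj Vsurj]] : exists f : nat -> R * R, set_bij `I_n V f.
  exact: (exists_enumeration c) Vn.
have angle i : {s | (i < n)%N -> 0 <= s < 2 * pi /\ f i = circle_pt c r s}.
  apply: cid; have [ltin|_] := ltnP i n; last by exists 0.
  by have [s s02 fi] := circle_angle c _ r r0 (Vcirc _ (Vf i ltin)); exists s.
pose a i := sval (angle i).
have aP i : (i < n)%N -> 0 <= a i < 2 * pi /\ f i = circle_pt c r (a i).
  exact: (svalP (angle i)).
pose s := sort <=%R [seq a i | i <- iota 0 n].
have size_s : size s = n by rewrite size_sort size_map size_iota.
have mem_s x : x \in s -> exists2 i, (i < n)%N & x = a i.
  by rewrite mem_sort => /mapP[i]; rewrite mem_iota; exists i.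
have s_mem i : (i < n)%N -> a i \in s.
  by move=> ltin; rewrite mem_sort map_f // mem_iota.
have sorted_s : sorted <%R s.
  rewrite lt_sorted_uniq_le sort_le_sorted andbT sort_uniq map_inj_in_uniq.
    exact: iota_uniq.
  move=> i j; rewrite !mem_iota /= !add0n => ltin ltjn aij.
  apply: Vinj; rewrite ?inE //.
  by rewrite (aP i ltin).2 (aP j ltjn).2 aij.
exists (fun i => if (i < n)%N then s`_i else s`_0 + 2 * pi); split=> [i ltin||p].
- rewrite ltin; have [lti1n|_] := ltnP i.+1 n.
    by rewrite lt_sorted_ltn_nth // inE size_s.
  have [j ltjn ->] : exists2 j, (j < n)%N & s`_i = a j.
    by apply: mem_s; rewrite mem_nth ?size_s.
  have [k ltkn ->] : exists2 k, (k < n)%N & s`_0 = a k.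
    by apply: mem_s; rewrite mem_nth ?size_s.
  by have [? _] := aP j ltjn; have [? _] := aP k ltkn; lra.
- by rewrite ltnn n0.
- split=> [Vp|[i ltin ->]].
    have [i /= ltin <-] := Vsurj _ Vp.
    have := s_mem i ltin; rewrite -index_mem size_s => lt_idx.
    exists (index (a i) s) => //; rewrite lt_idx nth_index ?s_mem //.
    exact: (aP i ltin).2.
  rewrite ltin; have [j ltjn ->] : exists2 j, (j < n)%N & s`_i = a j.
    by apply: mem_s; rewrite mem_nth ?size_s.
  by rewrite -(aP j ltjn).2; exact: Vf.
Qed.

(** * The sides and their disks *)

Section Polygon.
Context {R : realType} (c : R * R) (r : R) (V : set (R * R)) (n : nat).
Context (t : nat -> R).
Hypotheses (r0 : 0 < r) (n1 : (1 < n)%N) (tV : vertex_angles c r V n t).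

Let pt := circle_pt c r.

Definition side i := arc c r (t i) (t i.+1).
Definition mid i := (t i + t i.+1) / 2.
Definition disk i := closed_disk (pt (mid i)) (edist (pt (t i)) (pt (mid i))).
Definition disks_meet i j := disk i `&` disk j != set0.

Lemma vertex_angle_lt i j : (i < j)%N -> (j <= n)%N -> t i < t j.
Proof.
case: tV => tS _ _; elim: j => // j IH; rewrite ltnS leq_eqVlt.
move=> /orP[/eqP-> //|ij] jn; first exact: tS.
by apply: lt_trans (tS j jn); apply: IH => //; exact: ltnW.
Qed.

Lemma vertex_angle_le i j : (i <= j)%N -> (j <= n)%N -> t i <= t j.
Proof.
rewrite leq_eqVlt => /orP[/eqP-> //|ij] jn.
exact/ltW/vertex_angle_lt.
Qed.

(** Here at least two vertices are needed: with a single one, the only arc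
    would be the whole circle. *)
Lemma side_lt_turn i : (i < n)%N -> t i < t i.+1 < t i + 2 * pi.
Proof.
move=> ltin; case: (tV) => tS tn _; rewrite tS //=.
have := vertex_angle_le _ _ ltin (leqnn n); rewrite tn => le1.
case: i ltin le1 => [|i] ltin le1; last first.
  by have := vertex_angle_lt _ _ (ltn0Sn i) (ltnW ltin); lra.
by have := vertex_angle_lt _ _ n1 (leqnn n); rewrite tn; lra.
Qed.

Lemma vertex_in i : (i <= n)%N -> V (pt (t i)).
Proof.
case: tV => _ tn VP; rewrite leq_eqVlt => /orP[/eqP ->|ltin]; apply/VP.
  exists 0%N; first exact: ltnW n1.
  by rewrite tn /pt circle_pt_turn.
by exists i.
Qed.

Lemma no_vertex_inside i s : (i < n)%N -> t i < s < t i.+1 -> ~ V (pt s).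
Proof.
move=> ltin /andP[lt_is lt_si]; case: (tV) => _ tn VP /VP[j ltjn e].
have t0i := vertex_angle_le _ _ (leq0n i) (ltnW ltin).
have tin := vertex_angle_le _ _ ltin (leqnn n).
have t0j := vertex_angle_le _ _ (leq0n j) (ltnW ltjn).
have tjn := vertex_angle_lt _ _ ltjn (leqnn n).
have sj : s = t j by apply: (circle_pt_inj_turn c r (t 0%N)) e => //; lra.
have [ij|ji] := ltnP i j.
  by have := vertex_angle_le _ _ ij (ltnW ltjn); lra.
by have := vertex_angle_le _ _ ji (ltnW ltin); lra.
Qed.

(** The sides are determined up to a common shift of both angles by a multiple
    of 2 pi.  Once a is shifted to some t i, the angle b cannot come before
    t (i + 1), where a vertex would lie inside side i, nor after it, where the
    vertex at t (i + 1) would lie between a and b. *)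
Lemma consecutiveP a b : consecutive c r V a b <->
  exists i (k : int), [/\ (i < n)%N, a = t i + k%:~R * (2 * pi) &
                          b = t i.+1 + k%:~R * (2 * pi)].
Proof.
split=> [[ab Va Vb Vab]|[i [k [ltin -> ->]]]]; last first.
  have lt2 := side_lt_turn i ltin.
  rewrite /consecutive !circle_pt_period; split.
  - by lra.
  - exact/vertex_in/ltnW.
  - exact: vertex_in.
  - move=> s sab; rewrite -(circle_pt_period _ _ s (- k)).
    by apply: (no_vertex_inside i) => //; rewrite mulrNz; lra.
case: (tV) => _ _ VP; have [i ltin e] := (VP _).1 Va.
have [k ak] := circle_pt_inj_mod _ _ _ _ r0 e.
exists i, k; split=> //.
have lt2 := side_lt_turn i ltin.
pose b' := b + (- k)%:~R * (2 * pi).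
have b'E : b' = b - k%:~R * (2 * pi) by rewrite /b' mulrNz mulNr.
have Vb' : V (pt b') by rewrite /pt circle_pt_period.
have [lt_b|lt_b|eq_b] := ltgtP b' (t i.+1); last by lra.
  by case: (no_vertex_inside i b' ltin _ Vb'); lra.
case: (Vab (t i.+1 + k%:~R * (2 * pi))); first by lra.
by rewrite circle_pt_period; exact: vertex_in.
Qed.

Lemma edist_ends i : edist (pt (t i.+1)) (pt (mid i)) = edist (pt (t i)) (pt (mid i)).
Proof.
rewrite !edist_circle_pt ?ltW //.
have -> : (t i.+1 - mid i) / 2 = - ((t i - mid i) / 2) by rewrite /mid; field.
by rewrite sinN normrN.
Qed.

Lemma arc_period a b (k : int) :
  arc c r (a + k%:~R * (2 * pi)) (b + k%:~R * (2 * pi)) = arc c r a b.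
Proof.
apply/seteqP; split=> _ [s /= sab <-].
  exists (s + (- k)%:~R * (2 * pi)); last exact: circle_pt_period.
  by move: sab; rewrite /= !in_itv /= mulrNz; lra.
exists (s + k%:~R * (2 * pi)); last exact: circle_pt_period.
by move: sab; rewrite /= !in_itv /=; lra.
Qed.

Lemma side_diskP S D : side_disk c r V S D <->
  exists2 i, (i < n)%N & S = side i /\ D = disk i.
Proof.
split=> [[a [b [rho [/consecutiveP[i [k [ltin -> ->]]] -> ea _ ->]]]]|].
  exists i => //; split; first exact: arc_period.
  move: ea.
  have -> : (t i + k%:~R * (2 * pi) + (t i.+1 + k%:~R * (2 * pi))) / 2 =
     mid i + k%:~R * (2 * pi) by rewrite /mid; field.
  by rewrite !circle_pt_period => <-.
move=> [i ltin [-> ->]].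
exists (t i), (t i.+1), (edist (pt (t i)) (pt (mid i))); split=> //.
  by apply/consecutiveP; exists i, 0; rewrite mul0r !addr0.
exact: edist_ends.
Qed.

(** The midpoint of side i is no vertex and belongs to no other side. *)
Lemma side_inj i j : (i < n)%N -> (j < n)%N -> side i = side j -> i = j.
Proof.
wlog suff : i j / (i < n)%N -> (j < n)%N -> side i = side j -> (i <= j)%N.
  move=> H ltin ltjn e; apply/eqP; rewrite eqn_leq.
  by rewrite (H i j) // (H j i).
move=> ltin ltjn e; rewrite leqNgt; apply/negP => ji.
have lt2 := side_lt_turn i ltin.
have : side i (pt (mid i)) by exists (mid i) => //=; rewrite in_itv /= /mid; lra.
rewrite e => -[s /=]; rewrite in_itv /= => sj es.
have t0j := vertex_angle_le _ _ (leq0n j) (ltnW ltjn).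
have tji := vertex_angle_le _ _ ji (ltnW ltin).
have tin := vertex_angle_le _ _ ltin (leqnn n).
case: (tV) => _ tn _.
have : s = mid i.
  by apply: (circle_pt_inj_turn c r (t 0%N)) es => //; rewrite /mid; lra.
by rewrite /mid; lra.
Qed.

Lemma edist_mid i k : (i < k)%N -> (k < n)%N ->
  edist (pt (mid i)) (pt (mid k)) = 2 * r * sin ((mid k - mid i) / 2).
Proof.
move=> ik kn; rewrite edistC edist_circle_pt ?ltW //; congr (_ * _).
have t0i := vertex_angle_le _ _ (leq0n i) (ltnW (ltn_trans ik kn)).
have tik := vertex_angle_le _ _ ik (ltnW kn).
have tkn := vertex_angle_le _ _ kn (leqnn n).
have lti := side_lt_turn i (ltn_trans ik kn).
have ltk := side_lt_turn k kn.
case: (tV) => _ tn _.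
by rewrite gtr0_norm // sin_gt0_pi // /mid; lra.
Qed.

Lemma radiusE i : (i < n)%N ->
  edist (pt (t i)) (pt (mid i)) = 2 * r * sin ((t i.+1 - t i) / 4).
Proof.
move=> ltin; rewrite edistC edist_circle_pt ?ltW //; congr (_ * _).
have lti := side_lt_turn i ltin.
have -> : (mid i - t i) / 2 = (t i.+1 - t i) / 4 by rewrite /mid; field.
by rewrite gtr0_norm // sin_gt0_pi //; have := pi_gt0 R; lra.
Qed.

(** If the disks meet, the distance of the centers is at most the sum of the
    radii; all these lengths are chords, and the factor 2 r cancels. *)
Lemma meet_sin i k : (i < k)%N -> (k < n)%N -> disks_meet i k ->
  sin ((mid k - mid i) / 2) <=
  sin ((t i.+1 - t i) / 4) + sin ((t k.+1 - t k) / 4).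
Proof.
move=> ik kn /set0P[p [p_i p_k]].
have r20 : 0 < 2 * r by rewrite mulr_gt0.
rewrite -(ler_pM2l r20) mulrDr -edist_mid // -!radiusE ?(ltn_trans ik) //.
apply: le_trans (edist_triangle _ _ p) _.
by rewrite [edist _ p]edistC; exact: lerD.
Qed.

(** Consecutive midpoints among those of sides i < j < k < l are separated by at
    least the halves of the two sides that they bisect, as crossing_sin
    requires; from l back to i this uses t n = t 0 + 2 pi. *)
Lemma no_crossing i j k l : (i < j)%N -> (j < k)%N -> (k < l)%N -> (l < n)%N ->
  disks_meet i k -> disks_meet j l -> False.
Proof.
move=> ij jk kl ln.
have [ik jl] := (ltn_trans ij jk, ltn_trans jk kl).
have kn := ltn_trans kl ln; have jn := ltn_trans jk kn.
move=> /(meet_sin _ _ ik kn) hik /(meet_sin _ _ jl ln) hjl.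
case: (tV) => tS tn _.
have := tS i (ltn_trans ij jn); have := tS j jn; have := tS k kn; have := tS l ln.
have := vertex_angle_le _ _ (leq0n i) (ltnW (ltn_trans ij jn)).
have := vertex_angle_le _ _ ij (ltnW jn).
have := vertex_angle_le _ _ jk (ltnW kn).
have := vertex_angle_le _ _ kl (ltnW ln).
have := vertex_angle_le _ _ ln (leqnn n).
rewrite tn => ? ? ? ? ? ? ? ? ?.
apply: (@crossing_sin _ ((t i.+1 - t i) / 4) ((t j.+1 - t j) / 4)
  ((t k.+1 - t k) / 4) ((t l.+1 - t l) / 4) ((mid j - mid i) / 2)
  ((mid k - mid j) / 2) ((mid l - mid k) / 2) ((2 * pi + mid i - mid l) / 2)).
9: by rewrite /mid; field.
9: by move: hik; congr (sin _ <= _); rewrite /mid; field.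
9: by move: hjl; congr (sin _ <= _); rewrite /mid; field.
all: rewrite /mid; lra.
Qed.

Lemma meet_adjacent i : disks_meet i i.+1.
Proof.
apply/set0P; exists (pt (t i.+1)); split; rewrite /disk /closed_disk //=.
by rewrite edist_ends.
Qed.

Lemma meet_first_last : disks_meet 0 n.-1.
Proof.
apply/set0P; exists (pt (t 0%N)); split; rewrite /disk /closed_disk //=.
rewrite -edist_ends prednK ?(ltnW n1) //.
by case: (tV) => _ -> _; rewrite /pt circle_pt_turn.
Qed.

(** * Counting the pairs of sides *)

Definition meeting_pairs : {set 'I_n * 'I_n} :=
  [set e : 'I_n * 'I_n | (e.1 < e.2)%N && disks_meet e.1 e.2]%SET.

Definition disjoint_index_pairs : {set 'I_n * 'I_n} :=
  [set e : 'I_n * 'I_n | (e.1 < e.2)%N && ~~ disks_meet e.1 e.2]%SET.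

Lemma card_index_pairs : (#|meeting_pairs| + #|disjoint_index_pairs|)%N = 'C(n, 2).
Proof.
rewrite -card_increasing_pairs.
rewrite -(cardsID [set e : 'I_n * 'I_n | disks_meet e.1 e.2]%SET).
congr (_ + _)%N; apply: eq_card => e; rewrite !inE //.
by rewrite andbC.
Qed.

Lemma noncrossing_meeting_pairs : noncrossing meeting_pairs.
Proof.
split=> [e|i j k l /andP[ij jk] kl]; rewrite !inE; first by case/andP.
move=> /andP[_ ik] /andP[_ jl].
exact: (no_crossing i j k l).
Qed.

(** Each side is paired with the next one, the last with side 0.  For two sides
    both would give the same pair, whence the bound on n. *)
Lemma leq_card_meeting_pairs : (2 < n)%N -> (n <= #|meeting_pairs|)%N.
Proof.
move=> n2; pose e (i : 'I_n) : 'I_n * 'I_n :=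
  if i.+1 == n then (Ordinal (ltnW n1), i) else (i, ordS i).
have ordSE (i : 'I_n) : i.+1 != n -> ordS i = i.+1 :> nat.
  by move=> iN /=; rewrite modn_small //; have := ltn_ord i; lia.
have e_inj : injective e.
  move=> i j; rewrite /e.
  case: (eqVneq i.+1 n) => ei; case: (eqVneq j.+1 n) => ej.
  - by move=> _; apply: val_inj => /=; lia.
  - by case=> /(congr1 (@nat_of_ord n)) + /(congr1 (@nat_of_ord n));
      rewrite (ordSE j) //=; lia.
  - by case=> /(congr1 (@nat_of_ord n)) + /(congr1 (@nat_of_ord n));
      rewrite (ordSE i) //=; lia.
  - by case.
rewrite -[X in (X <= _)%N]card_ord -(card_imset _ e_inj).
apply/subset_leq_card/fintype.subsetP => _ /imsetP[i _ ->].
rewrite /e inE; have [ei|ei] := eqVneq i.+1 n => /=.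
  have -> : i = n.-1 :> nat by lia.
  by rewrite meet_first_last andbT; lia.
by rewrite modn_small ?ltnSn ?meet_adjacent //; have := ltn_ord i; lia.
Qed.

(** Listing each pair with the smaller index first turns the unordered pairs
    of sides into pairs of indices. *)
Lemma disjoint_pairsE : disjoint_pairs c r V =
  (fun e : 'I_n * 'I_n => [set side e.1; side e.2]) @`
    [set e | e \in disjoint_index_pairs].
Proof.
apply/seteqP; split=> P.
  move=> [S1 [S2 [D1 [D2 [/side_diskP[i ltin [-> ->]] /side_diskP[j ltjn [-> ->]]]]]]].
  move=> Sij Dij ->.
  have [ij|ji|e] := ltngtP i j; last by rewrite e in Sij.
    exists (Ordinal ltin, Ordinal ltjn) => //=.
    by rewrite inE /= ij /disks_meet Dij eqxx.
  exists (Ordinal ltjn, Ordinal ltin) => /=; last exact: setUC.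
  by rewrite inE /= ji /disks_meet setIC Dij eqxx.
move=> [[i j]] /=; rewrite inE /= => /andP[ij /negPn/eqP Dij] <-.
exists (side i), (side j), (disk i), (disk j); split=> //.
- by apply/side_diskP; exists i.
- by apply/side_diskP; exists j.
- by move/(side_inj _ _ (ltn_ord i) (ltn_ord j)); lia.
Qed.

Lemma pair_of_sides_inj : {in [set e : 'I_n * 'I_n | (e.1 < e.2)%N]%SET &,
  injective (fun e : 'I_n * 'I_n => [set side e.1; side e.2])}.
Proof.
have side_eq (i j k : 'I_n) : [set side i; side j] (side k) -> k = i \/ k = j.
  by case=> /= /(side_inj _ _ (ltn_ord _) (ltn_ord _)) e; [left|right];
    exact: val_inj.
move=> [i j] [k l]; rewrite !inE /= => ij kl e.
have /side_eq hi : [set side k; side l] (side i) by rewrite -e; left.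
have /side_eq hj : [set side k; side l] (side j) by rewrite -e; right.
by case: hi hj ij => -> [] -> ij //; move: kl; rewrite ?ltnn in ij *; lia.
Qed.

Lemma card_disjoint_pairs : disjoint_pairs c r V #= `I_(#|disjoint_index_pairs|).
Proof.
have -> : disjoint_pairs c r V =
    (fun k : 'I_#|disjoint_index_pairs| =>
       [set side (enum_val k).1; side (enum_val k).2]) @` [set: _].
  rewrite disjoint_pairsE; apply/seteqP; split=> _ [e /= He <-].
    by exists (enum_rank_in He e) => //=; rewrite enum_rankK_in.
  by exists (enum_val e) => //=; exact: enum_valP.
rewrite (card_eql (inj_card_eq _)) 1?card_eq_sym ?card_II //.
move=> k l _ _ e; apply: enum_val_inj; apply: pair_of_sides_inj e.
  by have := enum_valP k; rewrite !inE => /andP[].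
by have := enum_valP l; rewrite !inE => /andP[].
Qed.

End Polygon.

Theorem theorem2p3 (R : realType) (n : nat) (c : R * R) (r : R)
    (V : set (R * R)) (hn : (3 <= n)%N) (hV : great_polygon n c r V) :
  exists d : nat,
    disjoint_pairs c r V #= `I_d /\
    (n%:R - 2) * (n%:R - 3) / 2 <= d%:R :> R /\
    d%:R <= n%:R * (n%:R - 3) / 2 :> R.
Proof.
have n1 : (1 < n)%N by exact: ltnW.
have [t tV] := exists_vertex_angles n c r V (ltnW n1) hV.
have r0 : 0 < r by case: hV.
exists #|disjoint_index_pairs c r n t|; split; first exact: card_disjoint_pairs.
have tot := card_index_pairs c r n t.
have ge_n := leq_card_meeting_pairs c r V n t r0 n1 tV hn.
have lt_2n : (#|meeting_pairs c r n t|.+3 <= n.*2)%N.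
  have := noncrossing_meeting_pairs c r V n t r0 n1 tV.
  case: n {hn hV tV tot ge_n} n1 => [|[|m]] // _ /noncrossing_card; lia.
have {}tot : #|meeting_pairs c r n t|%:R * 2 + #|disjoint_index_pairs c r n t|%:R * 2
    = n%:R * (n%:R - 1) :> R.
  have : ((#|meeting_pairs c r n t| + #|disjoint_index_pairs c r n t|) * 2 = n * n.-1)%N.
    by rewrite tot -[2%N]/(2`!) bin_ffact ffactnS ffactn1.
  move/(congr1 (fun k => k%:R : R)).
  rewrite natrM natrD mulrDl => ->; rewrite natrM -subn1 natrB //; exact: ltnW.
have {}ge_n : n%:R <= #|meeting_pairs c r n t|%:R :> R by rewrite ler_nat.
have {}lt_2n : #|meeting_pairs c r n t|%:R + 3 <= n%:R * 2 :> R.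
  by rewrite -natrD -natrM ler_nat addn3 muln2.
by split; lra.
Qed.
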